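(* (Dispatch-Following Incentive Compatibility) Under the proposed joint electricity-carbon pricing mechanism defined in the context, the strategic generators and loads would produce the socially optimal dispatch $(p^*,d^* )$ by themselves in ex-post, given the realized joint electricity-carbon prices $\lambda_i^{\rm pro}$, $\lambda_j^{\rm pro}$ and the carbon tax rate $\delta\kappa$. That is, if each generator $i\in\mathcal{I}$ chooses its production $\tilde p_i$ as an optimal solution of its individual net-profit maximization problem $$\max_{0\le p_i\le\overline{P}_i}\ -(c_i+\delta\kappa e_i)p_i+\lambda_i^{\rm pro}p_i,$$ and each load $j\in\mathcal{J}$ chooses its demand $\tilde d_j$ as an optimal solution of its individual net-utility maximization problem $$\max_{0\le d_j\le\overline{D}_j}\ b_jd_j-\lambda_j^{\rm pro}d_j,$$ then the resulting dispatch is $(\tilde p,\tilde d)=(p^*,d^* )$.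
   Context: Data: a power system with a set $\mathcal{I}$ of generators, a set $\mathcal{J}$ of loads and a set $\mathcal{L}$ of transmission lines; marginal generation costs $c_i$, carbon emission factors $e_i$ and maximum productions $\overline{P}_i$ ($i\in\mathcal{I}$); marginal utilities $b_j$ and maximum consumptions $\overline{D}_j$ ($j\in\mathcal{J}$); nonnegative line capacities $F_l$ and node-to-line transfer factors $\pi_{il},\pi_{jl}$ ($l\in\mathcal{L}$); a coefficient $\kappa$ converting carbon emissions into monetary value; a factor $\delta\in[0,1]$. Carbon-aware social welfare maximization (SW): $$O^*=\max_{p,d}\ \sum_{j}b_jd_j-\sum_i(c_i+\kappa e_i)p_i$$ subject to $\sum_i p_i=\sum_j d_j$; $0\le p_i\le\overline{P}_i$ for all $i$; $0\le d_j\le\overline{D}_j$ for all $j$; $-F_l\le\sum_i\pi_{il}p_i-\sum_j\pi_{jl}d_j\le F_l$ for all $l$. The optimal dispatch of (SW) is denoted $(p^*,d^* )$ and called the socially optimal dispatch. Market-clearing problem (MC$_\delta$), in variables $p,d,\lambda,\underline\mu,\overline\mu,\underline\phi,\overline\phi,\underline\chi,\overline\chi$ (its constraints are the primal-dual optimality conditions of (SW)): $$\max\ \sum_j b_jd_j-\sum_i(c_i+\delta\kappa e_i)p_i$$ subject to (a) $\sum_ip_i=\sum_jd_j$ [multiplier $\tau\in\mathbb{R}$]; (b) $0\le p_i\le\overline{P}_i$ for all $i$; (c) $0\le d_j\le\overline{D}_j$ for all $j$; (d) $-F_l\le\sum_i\pi_{il}p_i-\sum_j\pi_{jl}d_j\le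 F_l$ for all $l$ [multipliers $\underline\alpha_l\ge0$ for the lower inequality, $\overline\alpha_l\ge0$ for the upper inequality]; (e) $-\lambda-\underline\mu_i+\overline\mu_i-\sum_l\pi_{il}(\overline\chi_l-\underline\chi_l)=-(c_i+\kappa e_i)$ for all $i$; (f) $\lambda-\underline\phi_j+\overline\phi_j+\sum_l\pi_{jl}(\overline\chi_l-\underline\chi_l)=b_j$ for all $j$; (g) $\underline\mu,\overline\mu,\underline\phi,\overline\phi,\underline\chi,\overline\chi\ge0$; (h) $\sum_i\overline\mu_i\overline{P}_i+\sum_j\overline\phi_j\overline{D}_j+\sum_l\overline\chi_lF_l+\sum_l\underline\chi_lF_l\le\sum_jb_jd_j-\sum_i(c_i+\kappa e_i)p_i$ [multiplier $\eta\ge0$]. Lagrangian dual of (MC$_\delta$): minimize over $\tau\in\mathbb{R}$, $\underline\alpha,\overline\alpha\ge0$, $\eta\ge0$ the maximum of $\mathscr{L}$ over $(p,d)$ satisfying (b),(c) and $(\lambda,\underline\mu,\overline\mu,\underline\phi,\overline\phi,\underline\chi,\overline\chi)$ satisfying (e)-(g), where $$\begin{aligned}\mathscr{L}=&\sum_jb_jd_j-\sum_i(c_i+\delta\kappa e_i)p_i+\tau\Big(\sum_ip_i-\sum_jd_j\Big)\\&+\sum_l\underline\alpha_l\Big(F_l+\sum_i\pi_{il}p_i-\sum_j\pi_{jl}d_j\Big)+\sum_l\overline\alpha_l\Big(F_l-\sum_i\pi_{il}p_i+\sum_j\pi_{jl}d_j\Big)\\&+\eta\Big(-\sum_i\overline\mu_i\overline{P}_i-\sum_j\overline\phi_j\overline{D}_j-\sum_l\overline\chi_lF_l-\sum_l\underline\chi_lF_l+\sum_jb_jd_j-\sum_i(c_i+\kappa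 e_i)p_i\Big).\end{aligned}$$ $\tau^*,\underline\alpha^*,\overline\alpha^*,\eta^*$ denote the values of these multipliers at the optimum; if the value of $\eta$ at the optimum is not unique, the smallest one is used as $\eta^*$. Pricing mechanism: each generator $i$ is paid $\lambda_i^{\rm pro}=\tau^*+\sum_l(\underline\alpha_l^*-\overline\alpha_l^* )\pi_{il}-\eta^*(c_i+\kappa e_i)$ per unit of production and pays a carbon tax at rate $\delta\kappa$ (i.e. the amount $\delta\kappa e_ip_i$); each load $j$ pays $\lambda_j^{\rm pro}=\tau^*+\sum_l(\underline\alpha_l^*-\overline\alpha_l^* )\pi_{jl}-\eta^*b_j$ per unit of consumption. Strategic generators and loads are net-profit- and net-utility-maximizing agents who take these prices and the tax rate as given.
   Formalization: Proved: $(p^*,d^* )$ is individually optimal, and every individual optimum equals it for agents whose price differs from their taxed marginal cost or marginal utility; if (SW) has several optima, $(p^*,d^* )$ is one with the best (MC$_\delta$) objective. *)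

(* Defs.v *)
From mathcomp Require Import all_boot all_order all_algebra.

Set Implicit Arguments.
Unset Strict Implicit.
Unset Printing Implicit Defensive.

Import Order.TTheory GRing.Theory Num.Theory.
Local Open Scope ring_scope.

Definition is_argmax (R : realFieldType) (T : Type) (S : T -> Prop)
    (f : T -> R) (x : T) : Prop :=
  S x /\ forall y, S y -> f y <= f x.

(* I: generators, J: loads, L: transmission lines *)
Record power_system (R : realFieldType) (I J L : finType) := PowerSystem {
  cost : I -> R;           (* c_i *)
  emission : I -> R;       (* e_i *)
  pmax : I -> R;
  utility : J -> R;        (* b_j *)
  dmax : J -> R;
  capacity : L -> R;       (* F_l *)
  gen_factor : I -> L -> R;
  load_factor : J -> L -> R;
  kappa : R
}.

Record dispatch (R : realFieldType) (I J : finType) := Dispatch {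
  gen : I -> R;
  load : J -> R
}.

(* The variables lambda, mu, phi, chi of the market-clearing problem, i.e. the
   dual variables of (SW); lo/up stand for under-/overlined. *)
Record sw_dual (R : realFieldType) (I J L : finType) := SwDual {
  lam : R;
  mu_lo : I -> R;
  mu_up : I -> R;
  phi_lo : J -> R;
  phi_up : J -> R;
  chi_lo : L -> R;
  chi_up : L -> R
}.

(* The multipliers tau, alpha, eta of the market-clearing problem. *)
Record multipliers (R : realFieldType) (L : finType) := Multipliers {
  tau : R;
  alpha_lo : L -> R;
  alpha_up : L -> R;
  eta : R
}.

Section Market.
Variables (R : realFieldType) (I J L : finType) (M : power_system R I J L).

Definition social_cost (i : I) : R := cost M i + kappa M * emission M i.

(* Marginal cost borne by generator i when carbon is taxed at rate
   delta * kappa. *)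
Definition taxed_cost (delta : R) (i : I) : R :=
  cost M i + delta * kappa M * emission M i.

Definition flow (s : dispatch R I J) (l : L) : R :=
  \sum_i gen_factor M i l * gen s i - \sum_j load_factor M j l * load s j.

Definition balanced (s : dispatch R I J) : Prop :=
  \sum_i gen s i = \sum_j load s j.

Definition gen_range (i : I) (x : R) : Prop := 0 <= x <= pmax M i.

Definition load_range (j : J) (x : R) : Prop := 0 <= x <= dmax M j.

Definition within_bounds (s : dispatch R I J) : Prop :=
  (forall i, gen_range i (gen s i)) /\ (forall j, load_range j (load s j)).

Definition line_limits (s : dispatch R I J) : Prop :=
  forall l, - capacity M l <= flow s l <= capacity M l.

Definition social_welfare (s : dispatch R I J) : R :=
  \sum_j utility M j * load s j - \sum_i social_cost i * gen s i.

Definition sw_feasible (s : dispatch R I J) : Prop :=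
  [/\ balanced s, within_bounds s & line_limits s].

Definition sw_optimal (s : dispatch R I J) : Prop :=
  is_argmax sw_feasible social_welfare s.

Definition sw_dual_feasible (y : sw_dual R I J L) : Prop :=
  [/\ forall i, - lam y - mu_lo y i + mu_up y i
          - \sum_l gen_factor M i l * (chi_up y l - chi_lo y l)
        = - social_cost i,
      forall j, lam y - phi_lo y j + phi_up y j
          + \sum_l load_factor M j l * (chi_up y l - chi_lo y l)
        = utility M j,
      forall i, 0 <= mu_lo y i /\ 0 <= mu_up y i,
      forall j, 0 <= phi_lo y j /\ 0 <= phi_up y j
    & forall l, 0 <= chi_lo y l /\ 0 <= chi_up y l].

Definition sw_dual_cost (y : sw_dual R I J L) : R :=
  \sum_i mu_up y i * pmax M i + \sum_j phi_up y j * dmax M j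
  + \sum_l chi_up y l * capacity M l + \sum_l chi_lo y l * capacity M l.

Definition mc_objective (delta : R) (s : dispatch R I J) : R :=
  \sum_j utility M j * load s j - \sum_i taxed_cost delta i * gen s i.

Definition mc_feasible (s : dispatch R I J) (y : sw_dual R I J L) : Prop :=
  [/\ sw_feasible s, sw_dual_feasible y
    & sw_dual_cost y <= social_welfare s].

Definition lagrangian (delta : R) (m : multipliers R L)
    (z : dispatch R I J * sw_dual R I J L) : R :=
  mc_objective delta z.1
  + tau m * (\sum_i gen z.1 i - \sum_j load z.1 j)
  + \sum_l alpha_lo m l * (capacity M l + flow z.1 l)
  + \sum_l alpha_up m l * (capacity M l - flow z.1 l)
  + eta m * (social_welfare z.1 - sw_dual_cost z.2).

Definition lagrangian_domain (z : dispatch R I J * sw_dual R I J L) : Prop :=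
  within_bounds z.1 /\ sw_dual_feasible z.2.

Definition multipliers_feasible (m : multipliers R L) : Prop :=
  [/\ forall l, 0 <= alpha_lo m l, forall l, 0 <= alpha_up m l & 0 <= eta m].

(* v is the value at m of the Lagrangian dual function (an attained maximum). *)
Definition dual_value (delta : R) (m : multipliers R L) (v : R) : Prop :=
  exists2 z, is_argmax lagrangian_domain (lagrangian delta m) z
           & v = lagrangian delta m z.

Definition mc_dual_optimal (delta : R) (m : multipliers R L) : Prop :=
  multipliers_feasible m /\
  exists2 v, dual_value delta m v
    & forall m' v', multipliers_feasible m' -> dual_value delta m' v' ->
        v <= v'.

(* Dual optimal, with the smallest eta when the optimal eta is not unique. *)
Definition pricing_multipliers (delta : R) (m : multipliers R L) : Prop :=
  mc_dual_optimal delta m /\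
  forall m', mc_dual_optimal delta m' -> eta m <= eta m'.

(* (SW) may have several optimal dispatches; "the" socially optimal dispatch
   is then one that is best for the market-clearing problem.  The second clause
   holds automatically if (SW) has a unique optimal dispatch or delta = 1,
   because by weak duality every market-clearing feasible dispatch is (SW)
   optimal. *)
Definition socially_optimal_dispatch (delta : R) (s : dispatch R I J) : Prop :=
  sw_optimal s /\
  forall s' y, mc_feasible s' y -> mc_objective delta s' <= mc_objective delta s.

Definition gen_price (m : multipliers R L) (i : I) : R :=
  tau m + \sum_l (alpha_lo m l - alpha_up m l) * gen_factor M i l
  - eta m * social_cost i.

Definition load_price (m : multipliers R L) (j : J) : R :=
  tau m + \sum_l (alpha_lo m l - alpha_up m l) * load_factor M j l
  - eta m * utility M j.

Definition gen_profit (delta : R) (m : multipliers R L) (i : I) (x : R) : R :=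
  - taxed_cost delta i * x + gen_price m i * x.

Definition load_profit (m : multipliers R L) (j : J) (x : R) : R :=
  utility M j * x - load_price m j * x.

Definition individually_optimal (delta : R) (m : multipliers R L)
    (s : dispatch R I J) : Prop :=
  (forall i, is_argmax (gen_range i) (gen_profit delta m i) (gen s i)) /\
  (forall j, is_argmax (load_range j) (load_profit m j) (load s j)).

End Market.

(* Main.v *)
Require Import Defs.
From Stdlib Require Import Classical.
From mathcomp Require Import all_boot all_order all_algebra ring lra.

Set Implicit Arguments.
Unset Strict Implicit.
Unset Printing Implicit Defensive.

Import Order.TTheory GRing.Theory Num.Theory.
Local Open Scope ring_scope.

(** Since the operator's Lagrangian relaxes exactly the constraints that couple
the agents, it is a sum of their individual profits, plus a term in which no
dispatch occurs ([lagrangian_separates]): the prices are precisely what makes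
the coefficient of a production or a consumption in the Lagrangian the marginal
profit of its owner.  Hence a dispatch that maximizes the Lagrangian gives every
agent an individually optimal quantity, and the issue is to show that the
socially optimal dispatch [s] maximizes the Lagrangian at the multipliers [m]
that fix the prices.

This is linear programming duality, used twice.  Strong duality for social
welfare maximization ([sw_strong_duality]) completes [s] with dual variables [y]
of zero duality gap, so that (s, y) is feasible, hence optimal, for market
clearing.  Strong duality for market clearing ([mc_strong_duality]) gives
multipliers whose Lagrangian never exceeds the objective at [s]; as [m] is dual
optimal, its Lagrangian does not exceed it either, while weak duality
([mc_feasible_lagrangian]) bounds the Lagrangian of [m] at (s, y) from below by
the same number.  So (s, y) is a maximizer ([dual_optimal_saddle]).

An agent's profit is linear in its own quantity.  When price and marginal cost
(or utility) differ the slope is nonzero and the maximizer is unique, which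
forces any other individually optimal choice to coincide with [s].

Both strong dualities are instances of [lagrange_multipliers]: a linear program
has Lagrange multipliers for any part of its constraints, the rest being kept as
the domain.  It comes from the Farkas lemma.  The points of the programs are
records of functions, not vectors of a module, so the Farkas lemma is proved
over an arbitrary type with an operation that is known only through the given
functions, which read it as forming linear combinations. *)

(** * The Farkas lemma *)

Section Farkas.
Variables (R : realFieldType) (T : Type) (comb : R -> T -> T -> T).

Definition comb_linear (f : T -> R) : Prop :=
  forall a x y, f (comb a x y) = a * f x + f y.

(** Induction on the constraints, after Bartl.  If the constraint [h]
cannot be dropped, some [e] satisfies the others and has [g e < 0], hence
[f h e < 0]; projecting along [e] onto the kernel of [f h] eliminates this
constraint, and undoing the projection gives [h] a positive coefficient. *)
Lemma farkas_seq (N : eqType) (r : seq N) (f : N -> T -> R) (g : T -> R) :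
  uniq r -> (forall k, comb_linear (f k)) -> comb_linear g ->
  (forall x, (forall k, k \in r -> 0 <= f k x) -> 0 <= g x) ->
  exists2 u : N -> R, forall k, 0 <= u k
    & forall x, g x = \sum_(k <- r) u k * f k x.
Proof.
elim: r f g => [|h r IHr] f g /=.
  move=> _ _ g_lin g_ge0; exists (fun=> 0) => // x; rewrite big_nil.
  (* [comb (-2) x x] plays the part of - x *)
  have := g_ge0 (comb (-2) x x) (fun _ => ltac:(by [])).
  have := g_ge0 x (fun _ => ltac:(by [])).
  rewrite g_lin; lra.
move=> /andP[h_r r_uniq] f_lin g_lin fg.
have [fg'|Nfg] :=
  classic (forall x, (forall k, k \in r -> 0 <= f k x) -> 0 <= g x).
  have [u u_ge0 gE] := IHr f g r_uniq f_lin g_lin fg'.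
  exists (fun k => if k == h then 0 else u k) => [k|x].
    by case: eqP.
  rewrite big_cons eqxx mul0r add0r gE; apply: eq_big_seq => k k_r.
  by case: eqP k_r h_r => // -> ->.
have [e Ne] := not_all_ex_not _ _ Nfg.
have [fe_ge0 /negP] := imply_to_and _ _ Ne; rewrite -ltNge => ge_lt0.
have he_lt0 : f h e < 0.
  rewrite ltNge; apply/negP => he_ge0.
  suff : 0 <= g e by rewrite leNgt ge_lt0.
  by apply: fg => k; rewrite inE => /predU1P[->|/fe_ge0].
have he_neq0 : f h e != 0 by rewrite lt_eqF.
pose proj (F : T -> R) x := F x - f h x / f h e * F e.
have projE F x : comb_linear F -> proj F x = F (comb (- (f h x / f h e)) e x).
  by move=> F_lin; rewrite F_lin /proj; ring.
have proj_lin F : comb_linear F -> comb_linear (proj F).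
  by move=> F_lin a x y; rewrite /proj !F_lin f_lin; field.
have [|||u u_ge0 gE] := IHr (fun k => proj (f k)) (proj g) r_uniq.
- by move=> k; apply: proj_lin.
- exact: proj_lin.
- move=> x fx_ge0; rewrite projE //; apply: fg => k; rewrite -projE // inE.
  by move=> /predU1P[->|/fx_ge0 //]; rewrite /proj divfK // subrr.
pose w := \sum_(k <- r) u k * f k e.
have w_ge0 : 0 <= w.
  by rewrite /w big_seq sumr_ge0 // => k k_r; rewrite mulr_ge0 ?fe_ge0.
exists (fun k => if k == h then (g e - w) / f h e else u k) => [k|x].
  case: eqP => // _; rewrite mulr_le0 ?invr_le0 ?ltW //; lra.
rewrite big_cons eqxx (eq_big_seq (fun k => u k * f k x)); last first.
  by move=> k k_r; case: eqP k_r h_r => // -> ->.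
have : proj g x = \sum_(k <- r) u k * f k x - f h x / f h e * w.
  rewrite gE /w mulr_sumr -sumrB; apply: eq_bigr => k _; rewrite /proj; ring.
by rewrite /proj => /eqP; rewrite subr_eq => /eqP ->; field.
Qed.

End Farkas.

(** * Lagrange multipliers for linear programs *)

Section Affine.
Variables (R : realFieldType) (T : Type) (line : R -> T -> T -> T).

(** [line a x y] stands for the point x + a (y - x) of the line through [x] and
[y]. *)
Definition line_affine (f : T -> R) : Prop :=
  forall a x y, f (line a x y) = f x + a * (f y - f x).

Lemma affine_cst c : line_affine (fun=> c).
Proof. by move=> a x y; ring. Qed.

Lemma affineD f g : line_affine f -> line_affine g ->
  line_affine (fun x => f x + g x).
Proof. by move=> fP gP a x y; rewrite fP gP; ring. Qed.

Lemma affineZ c f : line_affine f -> line_affine (fun x => c * f x).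
Proof. by move=> fP a x y; rewrite fP; ring. Qed.

Lemma affineZr c f : line_affine f -> line_affine (fun x => f x * c).
Proof. by move=> fP a x y; rewrite fP; ring. Qed.

Lemma affineN f : line_affine f -> line_affine (fun x => - f x).
Proof. by move=> fP a x y; rewrite fP; ring. Qed.

Lemma affineB f g : line_affine f -> line_affine g ->
  line_affine (fun x => f x - g x).
Proof. by move=> fP gP; apply: affineD => //; apply: affineN. Qed.

Lemma affine_sum (K : finType) (f : K -> T -> R) :
  (forall k, line_affine (f k)) -> line_affine (fun x => \sum_k f k x).
Proof.
move=> fP a x y; rewrite (eq_bigr _ (fun k _ => fP k a x y)).
by rewrite big_split /= -mulr_sumr sumrB.
Qed.

(** Homogenization: an affine function F of [x] becomes the linear function
t F(z) + (F(x) - F(z)) of [(t, x)], with [z] as the origin, and t >= 0 is added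
as a constraint, whose coefficient is the constant by which the two sides of the
conclusion differ.  Feasibility of [z] is what settles t = 0, where [(0, x)]
stands for the direction from [z] to [x]. *)
Lemma affine_farkas (N : finType) (f : N -> T -> R) (g : T -> R) (z : T) :
  (forall k, line_affine (f k)) -> line_affine g ->
  (forall k, 0 <= f k z) ->
  (forall x, (forall k, 0 <= f k x) -> 0 <= g x) ->
  exists2 u : N -> R, forall k, 0 <= u k
    & forall x, \sum_k u k * f k x <= g x.
Proof.
move=> f_aff g_aff fz_ge0 fg.
(* the second component is z + a (p.2 - z) + (q.2 - z) *)
pose comb a (p q : R * T) :=
  (a * p.1 + q.1, line 2 z (line (1 / 2) (line a z p.2) q.2)).
pose hom (F : T -> R) (p : R * T) := p.1 * F z + (F p.2 - F z).
have hom_lin F : line_affine F -> comb_linear comb (hom F).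
  by move=> FP a p q; rewrite /hom /comb /= !FP; field.
pose F (k : option N) := if k is Some k' then hom (f k') else fst.
have [|k||[t x] Fx_ge0|u u_ge0 gE] :=
    @farkas_seq R _ comb (option N) (index_enum (option N)) F (hom g).
- exact: index_enum_uniq.
- by case: k => [k|] /=; [exact: hom_lin | move=> a p q].
- exact: hom_lin.
- have t_ge0 : 0 <= t by apply: (Fx_ge0 None); rewrite mem_index_enum.
  have {Fx_ge0} fx_ge0 k : 0 <= hom (f k) (t, x).
    by apply: (Fx_ge0 (Some k)); rewrite mem_index_enum.
  have [t_gt0|t_le0] := ltP 0 t.
    have homE G : line_affine G -> hom G (t, x) = t * G (line t^-1 z x).
      by move=> GP; rewrite GP /hom /=; field; rewrite gt_eqF.
    rewrite homE // pmulr_rge0 //; apply: fg => k.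
    by have := fx_ge0 k; rewrite homE // pmulr_rge0.
  have t0 : t = 0 by lra.
  rewrite {}t0 /hom /= in fx_ge0 *; rewrite mul0r add0r leNgt.
  apply/negP => slope_lt0.
  (* every constraint holds on the ray from [z] through [x], where [g] would
     reach the value -1 *)
  pose a := (g z + 1) / (g z - g x).
  have gz_ge0 : 0 <= g z by apply: fg.
  have a_ge0 : 0 <= a by rewrite divr_ge0 //; lra.
  suff : 0 <= g (line a z x).
    have -> : g (line a z x) = -1.
      by rewrite g_aff /a; field; rewrite gt_eqF //; lra.
    lra.
  apply: fg => k; rewrite f_aff addr_ge0 // mulr_ge0 //.
  by have := fx_ge0 k; rewrite mul0r add0r.
exists (fun k => u (Some k)) => // x.
have homE G : hom G (1, x) = G x by rewrite /hom /=; ring.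
have := gE (1, x).
rewrite homE => ->; rewrite [leRHS](bigD1 None) //=.
have -> : \sum_(k | k != None) u k * F k (1, x) = \sum_k u (Some k) * f k x.
  rewrite (reindex_omap Some id) /=; last by case.
  by apply: eq_big => [k|k _]; rewrite ?eqxx // homE.
by rewrite mulr1 lerDr.
Qed.

(** The index type of the inequalities is packed with them so that finite choice
can select a system for each member of a family ([polyhedral_forall]). *)
Definition polyhedral (X : T -> Prop) : Prop :=
  exists w : {N : finType & N -> T -> R},
    (forall k, line_affine (tagged w k)) /\
    (forall x, X x <-> forall k, 0 <= tagged w k x).

Lemma polyhedral_le f g : line_affine f -> line_affine g ->
  polyhedral (fun x => f x <= g x).
Proof.
move=> fP gP; exists (Tagged (fun N : finType => N -> T -> R)
  (fun (_ : unit) x => g x - f x)).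
split=> [_|x] /=; first exact: affineB.
by rewrite -subr_ge0; split=> // /(_ tt).
Qed.

Lemma polyhedral_forall (K : finType) (X : K -> T -> Prop) :
  (forall k, polyhedral (X k)) -> polyhedral (fun x => forall k, X k x).
Proof.
move=> /fin_all_exists[w wP].
exists (Tagged (fun N : finType => N -> T -> R)
  (fun (k : {k : K & tag (w k)}) x => tagged (w (tag k)) (tagged k) x)).
split=> [[k n]|x] /=; first by have [] := wP k.
split=> [Xx [k n]|ge0 k].
  by have [_ /(_ x)[+ _]] := wP k; apply; apply: Xx.
have [_ /(_ x)[_]] := wP k; apply=> n.
exact: (ge0 (Tagged (fun k => tag (w k)) n)).
Qed.

Lemma polyhedral_iff X Y :
  (forall x, X x <-> Y x) -> polyhedral X -> polyhedral Y.
Proof. by move=> XY [w [wa wX]]; exists w; split=> // x; rewrite -XY. Qed.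

Lemma polyhedral_and X Y : polyhedral X -> polyhedral Y ->
  polyhedral (fun x => X x /\ Y x).
Proof.
move=> XP YP.
apply: (@polyhedral_iff (fun x => forall b : bool, if b then X x else Y x)).
  move=> x; split=> [XY|[? ?] []//].
  by split; [apply: (XY true) | apply: (XY false)].
by apply: polyhedral_forall => -[].
Qed.

Lemma polyhedral_eq f g : line_affine f -> line_affine g ->
  polyhedral (fun x => f x = g x).
Proof.
move=> fP gP; apply: polyhedral_iff
  (polyhedral_and (polyhedral_le fP gP) (polyhedral_le gP fP)).
by move=> x; split=> [[? ?]|->//]; apply/eqP; rewrite eq_le; apply/andP.
Qed.

(** The Farkas lemma for [v - f] yields nonnegative coefficients for all the
constraints; those that define [X] can be dropped, since they contribute
nonnegative terms on [X]. *)
Lemma lagrange_ineq (X : T -> Prop) (K : finType) (g : K -> T -> R)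
    (f : T -> R) (v : R) (z : T) :
  polyhedral X -> (forall k, line_affine (g k)) -> line_affine f ->
  X z -> (forall k, 0 <= g k z) ->
  (forall x, X x -> (forall k, 0 <= g k x) -> f x <= v) ->
  exists2 u : K -> R, forall k, 0 <= u k
    & forall x, X x -> f x + \sum_k u k * g k x <= v.
Proof.
move=> [[N h] /= [h_aff XE]] g_aff f_aff Xz gz_ge0 fv.
pose F (k : K + N) := match k with inl k => g k | inr n => h n end.
have [|||x Fx_ge0|u u_ge0 uF] :=
    @affine_farkas (K + N)%type F (fun x => v - f x) z.
- by case.
- by apply: affineB => //; apply: affine_cst.
- by case=> [//|n]; move/XE: Xz; apply.
- rewrite subr_ge0; apply: fv => [|k]; last exact: (Fx_ge0 (inl k)).
  by apply/XE => n; apply: (Fx_ge0 (inr n)).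
exists (fun k => u (inl k)) => // x /XE hx_ge0.
have := uF x; rewrite big_sumType /=.
have : 0 <= \sum_n u (inr n) * h n x.
  by apply: sumr_ge0 => n _; rewrite mulr_ge0.
lra.
Qed.

(** The multiplier of [e] is free in sign, being the difference of those of
[e] >= 0 and of - [e] >= 0. *)
Lemma lagrange_multipliers (X : T -> Prop) (K : finType) (e : T -> R)
    (g : K -> T -> R) (f : T -> R) (v : R) (z : T) :
  polyhedral X -> line_affine e -> (forall k, line_affine (g k)) ->
  line_affine f ->
  X z -> e z = 0 -> (forall k, 0 <= g k z) ->
  (forall x, X x -> e x = 0 -> (forall k, 0 <= g k x) -> f x <= v) ->
  exists c : R, exists2 u : K -> R, forall k, 0 <= u k
    & forall x, X x -> f x + c * e x + \sum_k u k * g k x <= v.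
Proof.
move=> XP e_aff g_aff f_aff Xz ez gz_ge0 fv.
pose G (k : bool + K) :=
  match k with inl b => fun x => (-1) ^+ b * e x | inr k => g k end.
have [|||u u_ge0 uG] :=
    @lagrange_ineq X (bool + K)%type G f v z XP _ f_aff Xz.
- by case=> [b|] //=; apply: affineZ.
- by case=> [b|] //=; rewrite ez mulr0.
- move=> x Xx Gx_ge0; apply: fv => // [|k]; last exact: (Gx_ge0 (inr k)).
  have := Gx_ge0 (inl false); have := Gx_ge0 (inl true).
  rewrite /= expr0 expr1; lra.
exists (u (inl false) - u (inl true)), (fun k => u (inr k)) => // x Xx.
apply: le_trans (uG x Xx).
rewrite big_sumType /= big_bool /= expr0 expr1 le_eqVlt; apply/orP; left.
by apply/eqP; ring.
Qed.

End Affine.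

Section Pair.
Variables (R : realFieldType) (A B : Type).
Variables (lineA : R -> A -> A -> A) (lineB : R -> B -> B -> B).

Definition pair_line (a : R) (x y : A * B) : A * B :=
  (lineA a x.1 y.1, lineB a x.2 y.2).

Lemma affine_fst f : line_affine lineA f ->
  line_affine pair_line (fun z => f z.1).
Proof. by move=> fP a x y; rewrite /= fP. Qed.

Lemma affine_snd f : line_affine lineB f ->
  line_affine pair_line (fun z => f z.2).
Proof. by move=> fP a x y; rewrite /= fP. Qed.

Lemma polyhedral_fst X : polyhedral lineA X ->
  polyhedral pair_line (fun z => X z.1).
Proof.
move=> [[N h] /= [h_aff XE]].
exists (Tagged (fun N : finType => N -> A * B -> R) (fun (k : N) z => h k z.1)).
by split=> [k|z] /=; [apply: affine_fst | apply: XE].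
Qed.

Lemma polyhedral_snd X : polyhedral lineB X ->
  polyhedral pair_line (fun z => X z.2).
Proof.
move=> [[N h] /= [h_aff XE]].
exists (Tagged (fun N : finType => N -> A * B -> R) (fun (k : N) z => h k z.2)).
by split=> [k|z] /=; [apply: affine_snd | apply: XE].
Qed.

End Pair.

(** * Separable and linear maximization *)

Section SumArgmax.
Variables (R : realFieldType) (K : finType).
Variables (S : K -> R -> Prop) (P : K -> R -> R).

Lemma argmax_of_sum (x : K -> R) :
  (forall k, S k (x k)) ->
  (forall y, (forall k, S k (y k)) -> \sum_k P k (y k) <= \sum_k P k (x k)) ->
  forall k, is_argmax (S k) (P k) (x k).
Proof.
move=> Sx x_max k; split=> // a Sa.
have /x_max : forall j, S j (if j == k then a else x j).
  by move=> j; case: eqP => // ->.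
rewrite (bigD1 k) //= [leRHS](bigD1 k) //= eqxx.
rewrite (eq_bigr (fun j => P j (x j))) ?lerD2r // => j /negPf -> //.
Qed.

End SumArgmax.

Lemma argmax_linear_eq (R : realFieldType) (S : R -> Prop) (f : R -> R)
    (a x y : R) :
  (forall z, f z = a * z) -> a != 0 ->
  is_argmax S f x -> is_argmax S f y -> y = x.
Proof.
move=> fE a0 [Sx fx] [Sy fy]; apply: (mulfI a0); rewrite -!fE.
by apply/eqP; rewrite eq_le fx // fy.
Qed.

(** * Market clearing as a linear program *)

Ltac affine :=
  first [ exact: affine_cst
        | by move=> ? ? ?
        | apply: affineB; affine | apply: affineN; affine
        | apply: affineD; affine | apply: affineZ; affine
        | apply: affineZr; affine | apply: affine_sum => ?; affine ].

Section MarketClearing.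
Variables (R : realFieldType) (I J L : finType) (M : power_system R I J L).

Implicit Types (s t : dispatch R I J) (y : sw_dual R I J L).
Implicit Types (m : multipliers R L).

Definition dispatch_line (a : R) s t : dispatch R I J :=
  Dispatch (fun i => gen s i + a * (gen t i - gen s i))
           (fun j => load s j + a * (load t j - load s j)).

Definition sw_dual_line (a : R) (x y : sw_dual R I J L) : sw_dual R I J L :=
  SwDual (lam x + a * (lam y - lam x))
    (fun i => mu_lo x i + a * (mu_lo y i - mu_lo x i))
    (fun i => mu_up x i + a * (mu_up y i - mu_up x i))
    (fun j => phi_lo x j + a * (phi_lo y j - phi_lo x j))
    (fun j => phi_up x j + a * (phi_up y j - phi_up x j))
    (fun l => chi_lo x l + a * (chi_lo y l - chi_lo x l))
    (fun l => chi_up x l + a * (chi_up y l - chi_up x l)).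

Notation z_line := (pair_line dispatch_line sw_dual_line).

Lemma affine_imbalance :
  line_affine dispatch_line (fun s => \sum_i gen s i - \sum_j load s j).
Proof. affine. Qed.

Lemma affine_social_welfare : line_affine dispatch_line (social_welfare M).
Proof. rewrite /social_welfare; affine. Qed.

Lemma affine_mc_objective delta :
  line_affine dispatch_line (mc_objective M delta).
Proof. rewrite /mc_objective; affine. Qed.

Lemma affine_sw_dual_cost : line_affine sw_dual_line (sw_dual_cost M).
Proof. rewrite /sw_dual_cost; affine. Qed.

Definition line_slack (k : L + L) s : R :=
  match k with
  | inl l => capacity M l + flow M s l
  | inr l => capacity M l - flow M s l
  end.

Lemma affine_line_slack k : line_affine dispatch_line (line_slack k).
Proof. by case: k => l; rewrite /line_slack /flow; affine. Qed.

Lemma line_limitsP s :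
  line_limits M s <-> forall k, 0 <= line_slack k s.
Proof.
rewrite /line_slack; split=> [lim [] l|ge0 l].
- by have /andP[] := lim l; lra.
- by have /andP[] := lim l; lra.
- by have := ge0 (inl l); have := ge0 (inr l); lra.
Qed.

Lemma polyhedral_within_bounds : polyhedral dispatch_line (within_bounds M).
Proof.
apply: polyhedral_and; apply: polyhedral_forall => k.
- apply: (@polyhedral_iff _ _ _
    (fun s => 0 <= gen s k /\ gen s k <= pmax M k)).
    by move=> s; rewrite /gen_range; split=> /andP.
  by apply: polyhedral_and; apply: polyhedral_le; affine.
- apply: (@polyhedral_iff _ _ _
    (fun s => 0 <= load s k /\ load s k <= dmax M k)).
    by move=> s; rewrite /load_range; split=> /andP.
  by apply: polyhedral_and; apply: polyhedral_le; affine.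
Qed.

Lemma polyhedral_sw_dual_feasible :
  polyhedral sw_dual_line (sw_dual_feasible M).
Proof.
pose signs y := (forall i, 0 <= mu_lo y i /\ 0 <= mu_up y i) /\
  (forall j, 0 <= phi_lo y j /\ 0 <= phi_up y j) /\
  (forall l, 0 <= chi_lo y l /\ 0 <= chi_up y l).
pose stationary y :=
  (forall i, - lam y - mu_lo y i + mu_up y i
      - \sum_l gen_factor M i l * (chi_up y l - chi_lo y l)
    = - social_cost M i) /\
  (forall j, lam y - phi_lo y j + phi_up y j
      + \sum_l load_factor M j l * (chi_up y l - chi_lo y l) = utility M j).
apply: (@polyhedral_iff _ _ _ (fun y => stationary y /\ signs y)).
  by move=> y; split=> [[[? ?] [? []]]|[]].
apply: polyhedral_and; last first.
  by do 2?[apply: polyhedral_and]; apply: polyhedral_forall => k;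
    apply: polyhedral_and; apply: polyhedral_le; affine.
by apply: polyhedral_and; apply: polyhedral_forall => k;
  apply: polyhedral_eq; affine.
Qed.

Lemma polyhedral_lagrangian_domain : polyhedral z_line (lagrangian_domain M).
Proof.
apply: polyhedral_and.
- exact: polyhedral_fst polyhedral_within_bounds.
- exact: polyhedral_snd polyhedral_sw_dual_feasible.
Qed.

(** * Weak and strong duality for the two problems *)

Lemma sum_flow (beta : L -> R) s :
  \sum_l beta l * flow M s l
    = \sum_i (\sum_l beta l * gen_factor M i l) * gen s i
      - \sum_j (\sum_l beta l * load_factor M j l) * load s j.
Proof.
under [X in _ = X - _]eq_bigr do rewrite mulr_suml.
under [X in _ = _ - X]eq_bigr do rewrite mulr_suml.
rewrite [X in _ = X - _]exchange_big [X in _ = _ - X]exchange_big -sumrB.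
apply: eq_bigr => l _; rewrite /flow mulrBr !mulr_sumr.
by congr (_ - _); apply: eq_bigr => k _; rewrite mulrA.
Qed.

(** The prices collect all that multiplies one agent's quantity once the flows
are expanded by node, which is why only the line rents and the dual cost are
left over. *)
Lemma lagrangian_separates delta m z :
  lagrangian M delta m z =
    \sum_i gen_profit M delta m i (gen z.1 i)
    + \sum_j load_profit M m j (load z.1 j)
    + \sum_l (alpha_lo m l + alpha_up m l) * capacity M l
    - eta m * sw_dual_cost M z.2.
Proof.
case: z => s y /=; rewrite /lagrangian /=.
pose beta l := alpha_lo m l - alpha_up m l.
have -> : \sum_i gen_profit M delta m i (gen s i) =
    - \sum_i taxed_cost M delta i * gen s i + tau m * \sum_i gen s i
    + \sum_i (\sum_l beta l * gen_factor M i l) * gen s i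
    - eta m * \sum_i social_cost M i * gen s i.
  rewrite !mulr_sumr -sumrN -!big_split -sumrB /=; apply: eq_bigr => i _.
  rewrite /gen_profit /gen_price; ring.
have -> : \sum_j load_profit M m j (load s j) =
    \sum_j utility M j * load s j - tau m * \sum_j load s j
    - \sum_j (\sum_l beta l * load_factor M j l) * load s j
    + eta m * \sum_j utility M j * load s j.
  rewrite !mulr_sumr -!sumrB -big_split /=; apply: eq_bigr => j _.
  rewrite /load_profit /load_price; ring.
have lines : \sum_l alpha_lo m l * (capacity M l + flow M s l)
      + \sum_l alpha_up m l * (capacity M l - flow M s l)
    = \sum_l (alpha_lo m l + alpha_up m l) * capacity M l
      + \sum_l beta l * flow M s l.
  rewrite -!big_split /=; apply: eq_bigr => l _; rewrite /beta; ring.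
move: lines; rewrite sum_flow /social_welfare /mc_objective => lines.
lra.
Qed.

Lemma mc_feasible_lagrangian delta m s y :
  multipliers_feasible m -> mc_feasible M s y ->
  mc_objective M delta s <= lagrangian M delta m (s, y).
Proof.
move=> [lo_ge0 up_ge0 eta_ge0] [[bal _ /line_limitsP lim] _ gap].
rewrite /lagrangian /= bal subrr mulr0 addr0 -addrA -addrA lerDl addrA.
rewrite !addr_ge0 ?mulr_ge0 ?subr_ge0 // sumr_ge0 // => l _;
  rewrite mulr_ge0 //.
- exact: (lim (inl l)).
- exact: (lim (inr l)).
Qed.

Lemma taxed_cost1 i : taxed_cost M 1 i = social_cost M i.
Proof. by rewrite /taxed_cost mul1r. Qed.

(** At [delta = 1] and [eta m = 0] the market-clearing Lagrangian is the one of
social welfare maximization. *)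
Lemma sw_multipliers s : sw_optimal M s ->
  exists2 m, multipliers_feasible m /\ eta m = 0
    & forall x y, within_bounds M x ->
        lagrangian M 1 m (x, y) <= social_welfare M s.
Proof.
move=> [[bal bnd lim] s_max].
have [|||x bx ex gx|c [u u_ge0 uP]] := lagrange_multipliers (z := s)
    (v := social_welfare M s) polyhedral_within_bounds affine_imbalance
    affine_line_slack affine_social_welfare.
- exact: bnd.
- by rewrite bal subrr.
- exact/line_limitsP.
- apply: s_max; split=> //; last exact/line_limitsP.
  by apply/eqP; rewrite -subr_eq0 ex.
exists (Multipliers c (fun l => u (inl l)) (fun l => u (inr l)) 0).
  by split=> //; split=> /=.
move=> x y bx; apply: le_trans (uP x bx).
rewrite /lagrangian /= big_sumType /= mul0r addr0 addrA.
have -> // : mc_objective M 1 x = social_welfare M x.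
by rewrite /mc_objective; under [X in _ - X]eq_bigr do rewrite taxed_cost1.
Qed.

(** Given the multipliers of the coupling constraints, [mu_up] and [phi_up] are
the rents of a unit of generation or load capacity, i.e. the positive parts of
the marginal profits, and [mu_lo] and [phi_lo] the negative parts.  The dual
cost is then the Lagrangian at the agents' best responses. *)
Lemma sw_strong_duality s : sw_optimal M s -> exists y, mc_feasible M s y.
Proof.
move=> s_opt; have [m [[lo_ge0 up_ge0 _] eta0] mP] := sw_multipliers s_opt.
have [s_feas _] := s_opt; have [_ [pbnd dbnd] _] := s_feas.
pose r i := gen_price M m i - social_cost M i.
pose q j := utility M j - load_price M m j.
(* in the stationarity conditions [chi_up] has the sign of the multiplier of the
   lower line limit, so [alpha_lo] is the value of [chi_up] *)
pose y := SwDual (tau m) (fun i => Num.max (- r i) 0) (fun i => Num.max (r i) 0)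
  (fun j => Num.max (- q j) 0) (fun j => Num.max (q j) 0)
  (alpha_up m) (alpha_lo m).
have split_max (a : R) : Num.max a 0 = a + Num.max (- a) 0.
  by rewrite !maxEge; case: ifP; case: ifP; lra.
have swap (pi : L -> R) : \sum_l pi l * (alpha_lo m l - alpha_up m l)
    = \sum_l (alpha_lo m l - alpha_up m l) * pi l.
  by apply: eq_bigr => l _; rewrite mulrC.
exists y; split=> //.
  split=> /= [i|j|i|j|l]; rewrite ?le_max ?lexx ?orbT //.
  - by rewrite swap (split_max (r i)) /r /gen_price eta0; ring.
  - by rewrite swap (split_max (q j)) /q /load_price eta0; ring.
pose best := Dispatch (fun i => if 0 <= r i then pmax M i else 0)
  (fun j => if 0 <= q j then dmax M j else 0).
apply: le_trans (mP best y _); last first.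
  split=> /= [i|j]; rewrite /gen_range /load_range.
  - have /andP[ge0 /(le_trans ge0) pmax_ge0] := pbnd i.
    by case: ifP => _; rewrite lexx ?andbT.
  - have /andP[ge0 /(le_trans ge0) dmax_ge0] := dbnd j.
    by case: ifP => _; rewrite lexx ?andbT.
rewrite lagrangian_separates eta0 mul0r subr0 /sw_dual_cost /= -addrA.
rewrite -big_split /=.
rewrite le_eqVlt; apply/orP; left; apply/eqP; congr (_ + _ + _).
- apply: eq_bigr => i _; rewrite /gen_profit taxed_cost1 maxEge -/(r i).
  by rewrite -mulrDl addrC -/(r i); case: ifP => _; ring.
- apply: eq_bigr => j _; rewrite /load_profit maxEge -mulrBl -/(q j).
  by case: ifP => _; ring.
- by apply: eq_bigr => l _; ring.
Qed.

Lemma mc_strong_duality delta s y :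
  mc_feasible M s y ->
  (forall s' y', mc_feasible M s' y' ->
     mc_objective M delta s' <= mc_objective M delta s) ->
  exists2 m, multipliers_feasible m
    & forall z, lagrangian_domain M z ->
        lagrangian M delta m z <= mc_objective M delta s.
Proof.
move=> [[bal bnd lim] dual gap] s_max.
pose g (k : L + L + unit) (z : dispatch R I J * sw_dual R I J L) :=
  match k with
  | inl k => line_slack k z.1
  | inr _ => social_welfare M z.1 - sw_dual_cost M z.2
  end.
have g_aff k : line_affine z_line (g k).
  case: k => [k|[]].
  - exact: affine_fst (affine_line_slack k).
  - apply: affineB; first exact: affine_fst affine_social_welfare.
    exact: affine_snd affine_sw_dual_cost.
have [|||[x y'] [bx dy] ex gx|c [u u_ge0 uP]] := lagrange_multipliers
    (z := (s, y)) (v := mc_objective M delta s) polyhedral_lagrangian_domain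
    (affine_fst sw_dual_line affine_imbalance) g_aff
    (affine_fst sw_dual_line (affine_mc_objective delta)).
- by split.
- by rewrite /= bal subrr.
- case=> [k|[]] /=; last by rewrite subr_ge0.
  by move/line_limitsP: lim; apply.
- apply: (s_max x y'); split=> //; last first.
    by have := gx (inr tt); rewrite subr_ge0.
  split=> //; first by apply/eqP; rewrite -subr_eq0; apply/eqP.
  by apply/line_limitsP => k; apply: (gx (inl k)).
exists (Multipliers c (fun l => u (inl (inl l))) (fun l => u (inl (inr l)))
  (u (inr tt))).
  by split=> /=.
move=> z zdom; apply: le_trans (uP z zdom).
rewrite /lagrangian !big_sumType /= (big_pred1 tt) //.
by rewrite [leRHS]addrA [in leRHS]addrA.
Qed.

(** * Individual optimality of the socially optimal dispatch *)

(** With v the dual value at [m] and m' multipliers from [mc_strong_duality],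
the Lagrangian of [m] is at most v anywhere, and v <= dual value at m' <=
objective at [s] <= Lagrangian of [m] at (s, y).  The maximum that defines the
dual value at m' is attained at (s, y), by weak duality again. *)
Lemma dual_optimal_saddle delta m s :
  socially_optimal_dispatch M delta s -> mc_dual_optimal M delta m ->
  exists y, is_argmax (lagrangian_domain M) (lagrangian M delta m) (s, y).
Proof.
move=> [s_opt s_best] [m_feas [v [z [_ z_max] ->] v_min]].
have [y sy_feas] := sw_strong_duality s_opt.
have [m' m'_feas m'_le] := mc_strong_duality sy_feas s_best.
have sy_dom : lagrangian_domain M (s, y) by have [[]] := sy_feas.
exists y; split=> // x x_dom.
apply: le_trans (mc_feasible_lagrangian delta m_feas sy_feas).
apply: le_trans (z_max x x_dom) _.
apply: le_trans (m'_le _ sy_dom).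
apply: (v_min m') => //; exists (s, y) => //.
split=> // x' /m'_le /le_trans; apply.
exact: mc_feasible_lagrangian.
Qed.

(** Varying the generation alone, or the load alone, keeps the point in the
Lagrangian's domain and changes only one of the separate sums of profits. *)
Lemma saddle_individually_optimal delta m s y :
  is_argmax (lagrangian_domain M) (lagrangian M delta m) (s, y) ->
  individually_optimal M delta m s.
Proof.
move=> [[[pbnd dbnd] dual] s_max]; split; apply: argmax_of_sum => // x x_rng.
- have := s_max (Dispatch x (load s), y) (conj (conj x_rng dbnd) dual).
  by rewrite !lagrangian_separates /= !lerD2r.
- have := s_max (Dispatch (gen s) x, y) (conj (conj pbnd x_rng) dual).
  by rewrite !lagrangian_separates /= !lerD2r lerD2l.
Qed.

End MarketClearing.

Theorem proposition3 (R : realFieldType) (I J L : finType)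
  (M : power_system R I J L) (delta : R)
  (hcap : forall l, 0 <= capacity M l)
  (hdelta : 0 <= delta <= 1)
  (s : dispatch R I J) (hs : socially_optimal_dispatch M delta s)
  (m : multipliers R L) (hm : pricing_multipliers M delta m) :
  individually_optimal M delta m s /\
  forall t : dispatch R I J, individually_optimal M delta m t ->
    (forall i, gen_price M m i <> taxed_cost M delta i -> gen t i = gen s i) /\
    (forall j, load_price M m j <> utility M j -> load t j = load s j).
Proof.
have [y /saddle_individually_optimal s_ind] := dual_optimal_saddle hs hm.1.
split=> // t t_ind; split=> [i /eqP|j /eqP]; rewrite -subr_eq0 => slope.
- apply: argmax_linear_eq slope (s_ind.1 i) (t_ind.1 i) => z.
  by rewrite /gen_profit; ring.
- rewrite -oppr_eq0 in slope.
  apply: argmax_linear_eq slope (s_ind.2 j) (t_ind.2 j) => z.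
  by rewrite /load_profit; ring.
Qed.
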